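(* Let $\mathbb{U}_{\mathbb{Q}_+,\leq 1}=(U;d)$ be the bounded Urysohn space. Let $R=\{r_i : i\in\omega\}$ be a set of rationals in the interval $(0,1]$, let $A=\{a_i : i\in\omega\}$ be a subset of $U$ such that $d(a_i,a_j)\geq r_i+r_j$ for all $i,j\in\omega$ with $i\neq j$, and let $$X:=\bigcup_{i\in\omega}\{x\in U : d(a_i,x)<r_i\}.$$ Then the metric subspace of $\mathbb{U}_{\mathbb{Q}_+,\leq 1}$ induced by $U\setminus X$ is an isometric copy of $\mathbb{U}_{\mathbb{Q}_+,\leq 1}$.
   Context: The age of a metric space is the class of all finite metric spaces that embed isometrically into it. A metric space is homogeneous if every isometry between two of its finite subspaces extends to an isometry of the space onto itself. $\mathbb{U}_{\mathbb{Q}_+,\leq 1}$ is the countable homogeneous metric space (unique up to isometry) whose age is the class of all finite metric spaces all of whose distances are rational numbers in $[0,1]$. *)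

(* Defs.v *)
From HB Require Import structures.
From mathcomp Require Import all_boot all_order all_algebra.
From mathcomp Require Import all_classical all_reals all_analysis.

Set Implicit Arguments.
Unset Strict Implicit.
Unset Printing Implicit Defensive.

Import Order.TTheory GRing.Theory Num.Theory.
Local Open Scope classical_set_scope.
Local Open Scope ring_scope.

(* The library already makes [set_type A], the subtype of the elements of A, a
   pseudometric space by pulling back the balls of the ambient space; this adds
   the restricted distance, so that a set A : set M, seen as a type, is the
   metric subspace of M induced by A. *)
Section metric_subspace.
Context {R : realType} {M : metricType R} (A : set M).

Let sub_mdist (x y : A) : R := mdist (\val x) (\val y).

Let sub_mdist_ge0 x y : 0 <= sub_mdist x y.
Proof. exact: mdist_ge0. Qed.

Let sub_mdist_positivity x y : sub_mdist x y = 0 -> x = y.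
Proof. by move=> /mdist_positivity/val_inj. Qed.

Let sub_ballE (x : A) (e : R) : ball x e = [set y | sub_mdist x y < e].
Proof.
have -> : ball x e = [set y | ball (\val x) e (\val y)] by [].
by rewrite ballEmdist.
Qed.

HB.instance Definition _ :=
  PseudoMetric_isMetric.Build R A sub_mdist_ge0 sub_mdist_positivity sub_ballE.

End metric_subspace.

Section urysohn.
Context {R : realType}.
Implicit Types M N F U : metricType R.

Definition isometric_embedding M N (f : M -> N) : Prop :=
  forall x y : M, mdist (f x) (f y) = mdist x y.

Definition isometry M N (f : M -> N) : Prop :=
  isometric_embedding f /\ bijective f.

Definition isometric M N : Prop := exists f : M -> N, isometry f.

Definition in_age M F : Prop :=
  finite_set [set: F] /\ exists f : F -> M, isometric_embedding f.

Definition homogeneous M : Prop :=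
  forall (A B : set M) (f : A -> B),
    finite_set A -> finite_set B -> isometry f ->
    exists g : M -> M, isometry g /\ forall x : A, g (\val x) = \val (f x).

(* U is countable and homogeneous, and its age consists of all finite metric
   spaces with rational distances in [0, 1]; these properties determine U up to
   isometry. *)
Definition bounded_rational_urysohn U : Prop :=
  [/\ countable [set: U],
      homogeneous U &
      forall F, in_age U F <->
        finite_set [set: F] /\
        forall x y : F, rational (mdist x y) /\ 0 <= mdist x y <= 1].

End urysohn.

(* Main.v *)
Require Import Defs.
From HB Require Import structures.
From mathcomp Require Import all_boot all_order all_algebra.
From mathcomp Require Import all_classical all_reals all_analysis.
From mathcomp Require Import lra.

(** Among countable metric spaces with rational distances in [0, 1], the bounded
    Urysohn space is characterized by the one-point extension property: every
    prescription of rational distances in [0, 1] to finitely many points that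
    does not contradict the triangle inequality is realized by a point. That
    the Urysohn space has this property follows from its age and its
    homogeneity ([urysohn_extension_property]), and two countable spaces with
    the property are isometric by a back-and-forth argument
    ([back_and_forth]). So it is enough to show that removing the balls
    preserves the extension property ([extension_property_remove_balls]).

    Infinitely many balls have to be avoided, while only finitely many distances
    can be prescribed. The way out is that the sphere around [a i] of radius
    [r i] misses all the balls: it misses the ball around [a i] because the
    balls are open, and the one around [a j] because
    [r i + r j <= mdist (a i) (a j)]. Realize the prescribed distances to
    points outside of the balls by some [z] in the whole space. If [z] lies in
    the ball around [a i], prescribe moreover the distance [r i] to [a i]. This
    is consistent: the given points are at distance at least [r i] from [a i],
    and [z] itself already satisfies the prescription with a distance to [a i]
    smaller than [r i]. A point realizing the enlarged prescription is outside
    of all the balls. *)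

Set Implicit Arguments.
Unset Strict Implicit.
Unset Printing Implicit Defensive.

Import Order.TTheory GRing.Theory Num.Theory.
Local Open Scope classical_set_scope.
Local Open Scope ring_scope.

(** * The one-point extension property *)

Section extension_property.
Context {R : realType}.
Implicit Types M N U : metricType R.

Definition unit_rational (t : R) : Prop := rational t /\ 0 <= t <= 1.

Definition unit_rational_metric M : Prop :=
  forall x y : M, unit_rational (mdist x y).

(** A pair in [s] prescribes the distance of a new point to a point of [M].
    Two prescriptions for the same point of [M] must agree, so such a list is
    the graph of a Katetov function on a finite subset of [M]. *)
Definition katetov M (s : seq (M * R)) : Prop :=
  {in s &, forall p q, p.2 - q.2 <= mdist p.1 q.1 <= p.2 + q.2}.

Definition extension_property M : Prop :=
  forall s : seq (M * R), katetov s -> {in s, forall p, unit_rational p.2} ->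
  exists z : M, {in s, forall p, mdist z p.1 = p.2}.

Lemma surjective_isometry M N (f : M -> N) :
  isometric_embedding f -> (forall y, exists x, f x = y) -> Defs.isometry f.
Proof.
move=> f_iso /choice[g fK]; split=> //; exists g => // x.
by apply: mdist_positivity; rewrite -f_iso fK mdistxx.
Qed.

Lemma mdist_katetov M (z x y : M) :
  mdist z x - mdist z y <= mdist x y <= mdist z x + mdist z y.
Proof.
have := metric_triangle z y x; have := metric_triangle x z y.
by rewrite (metric_sym x z) (metric_sym y x); lra.
Qed.

End extension_property.

(** * The Urysohn space has the extension property *)

(** The finite metric space formed by the points listed in [s] and a new point
    [None] at the prescribed distances. The proofs are parameters of the type
    because the metric structure attached to it depends on them: positivity of
    the distance fails as soon as a prescribed distance is zero. *)
Definition one_point_extension (R : realType) (M : metricType R)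
    (s : seq (M * R)) of katetov s & {in s, forall p, 0 < p.2} : Type :=
  option (seq_sub s).

Section one_point_extension.
Context {R : realType} {M : metricType R} (s : seq (M * R)).
Hypotheses (s_kat : katetov s) (s_gt0 : {in s, forall p, 0 < p.2}).

Let E := one_point_extension s_kat s_gt0.

HB.instance Definition _ := Choice.copy E (option (seq_sub s)).

Let dist (x y : E) : R :=
  match x, y with
  | Some p, Some q => mdist (\val p).1 (\val q).1
  | Some p, None | None, Some p => (\val p).2
  | None, None => 0
  end.

Let distxx x : dist x x = 0.
Proof. by case: x => [p|] //=; exact: mdistxx. Qed.

Let dist_positivity x y : dist x y = 0 -> x = y.
Proof.
case: x y => [[p ps]|] [[q qs]|] //= => [/mdist_positivity pq||].
- congr Some; apply: val_inj => /=.
  have := s_kat ps qs; have := s_kat qs ps; rewrite pq mdistxx.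
  by case: p q pq {ps qs} => [x a] [y b] /= -> ? ?; congr pair; lra.
- by move=> p0; have := s_gt0 ps; rewrite p0 ltxx.
- by move=> q0; have := s_gt0 qs; rewrite q0 ltxx.
Qed.

Let dist_sym x y : dist x y = dist y x.
Proof. by case: x y => [p|] [q|] //=; exact: metric_sym. Qed.

Let dist_triangle y x z : dist x z <= dist x y + dist y z.
Proof.
case: x y z => [[p ps]|] [[q qs]|] [[t ts]|] //=; try exact: metric_triangle.
- by have := s_kat ps qs; lra.
- by have := s_kat ps ts; lra.
- lra.
- by have := s_kat ts qs; rewrite (metric_sym t.1); lra.
- by have := s_gt0 qs; lra.
- lra.
Qed.

HB.instance Definition _ := isMetric.Build R E
  distxx dist_positivity dist_sym dist_triangle.

End one_point_extension.

Section urysohn.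
Context {R : realType} (U : metricType R).
Hypothesis hU : bounded_rational_urysohn U.

(** Two points of the space form a finite subspace, which belongs to the age. *)
Lemma urysohn_unit_rational : unit_rational_metric U.
Proof.
case: hU => _ _ age x y.
have [|_ xy_rat] := (age (set_type [set x; y])).1.
  split; last by exists \val.
  by rewrite (eq_finite_set (card_setT _)); exact: finite_set2.
have xP : x \in [set x; y] by rewrite inE; left.
have yP : y \in [set x; y] by rewrite inE; right.
exact: (xy_rat (SigSub xP) (SigSub yP)).
Qed.

(** The one-point extension has rational distances in [0, 1], so it embeds into
    the space by some [g]. The points listed in [s] are then isometric to their
    images under [g]; by homogeneity an isometry of the whole space realizes
    this identification, and its inverse moves the image of the new point to a
    point at the prescribed distances. *)
Lemma urysohn_extension_property : extension_property U.
Proof.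
case: hU => _ homU age s s_kat s_rat.
(* A point at prescribed distance zero is itself the required point. *)
have [[p ps p0]|s_neq0] := pselect (exists2 p, p \in s & p.2 = 0).
  exists p.1 => q qs; have := s_kat _ _ ps qs; have := s_kat _ _ qs ps.
  by rewrite p0 (metric_sym q.1); lra.
have s_gt0 : {in s, forall p, 0 < p.2}.
  move=> p ps; have [_ /andP[p_ge0 _]] := s_rat _ ps.
  rewrite lt_neqAle p_ge0 andbT eq_sym; apply/eqP => p0.
  by apply: s_neq0; exists p.
pose E := one_point_extension s_kat s_gt0.
have [|_ [g g_iso]] := (age E).2.
  split; first exact: (@finite_finset (option (seq_sub s))).
  have rat0 : unit_rational (0 : R).
    by split; [exists 0 => //; rewrite rmorph0|rewrite lexx ler01].
  case=> [[p ps]|] [[q qs]|]; first exact: urysohn_unit_rational.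
  - exact: s_rat.
  - exact: s_rat.
  - exact: rat0.
pose A : set U := [set` map fst s].
have pre (x : A) : exists p : seq_sub s, (\val p).1 = \val x.
  have /set_mem/mapP[p ps xE] := valP x.
  by exists (SeqSub ps).
have [pt ptE] := choice pre.
pose B : set U := range (fun x : A => g (Some (pt x))).
have inB x : g (Some (pt x)) \in B by rewrite inE; exists x.
have A_fin : finite_set A by exact: finite_seq.
have [|||h [[h_iso [k hK kK]] hE]] := homU A B (fun x => SigSub (inB x)).
- exact: A_fin.
- by apply: finite_image; rewrite (eq_finite_set (card_setT _)).
- apply: surjective_isometry => [x y|[y yB]].
    by rewrite -[RHS]/(mdist (\val x) (\val y)) -!ptE; exact: g_iso.
  have /set_mem[x _ xE] := yB; exists x; exact: val_inj.
exists (k (g None)) => p ps.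
have pA : p.1 \in A by rewrite inE; exact: map_f.
rewrite -h_iso kK (hE (SigSub pA)) g_iso.
rewrite -[LHS]/((\val (pt (SigSub pA))).2).
(* The entry [q] chosen for the point [p.1] may differ from [p], but the Katetov
   condition forces equal prescribed distances. *)
have := ptE (SigSub pA); case: (pt _) => q qs /= qp.
by have := s_kat _ _ ps qs; have := s_kat _ _ qs ps; rewrite qp mdistxx; lra.
Qed.

End urysohn.

(** * Uniqueness of the countable space with the extension property *)

Section back_and_forth.
Context {R : realType}.
Implicit Types M N : metricType R.

Definition partial_isometry M N (S : seq (M * N)) : Prop :=
  {in S &, forall p q, mdist p.1 q.1 = mdist p.2 q.2}.

(** The distances from [v] to the range of [S], carried back to the domain of
    [S], form a Katetov function there. *)
Lemma partial_isometry_extend M N (S : seq (M * N)) (v : N) :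
  extension_property M -> unit_rational_metric N -> partial_isometry S ->
  exists u, partial_isometry ((u, v) :: S).
Proof.
move=> extM ratN S_iso.
have [||u uE] := extM [seq (p.1, mdist v p.2) | p <- S].
- move=> _ _ /mapP[p pS ->] /mapP[q qS ->] /=; rewrite (S_iso p q)//.
  exact: mdist_katetov.
- by move=> _ /mapP[p pS ->]; exact: ratN.
have {}uE p : p \in S -> mdist u p.1 = mdist v p.2.
  by move=> pS; rewrite (uE (p.1, mdist v p.2))//; apply/mapP; exists p.
exists u => p q; rewrite !inE => /predU1P[->|pS] /predU1P[->|qS] /=.
- by rewrite !mdistxx.
- exact: uE.
- by rewrite metric_sym [RHS]metric_sym; exact: uE.
- exact: S_iso.
Qed.

Definition swap {A B : Type} (p : A * B) : B * A := (p.2, p.1).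

Lemma partial_isometry_swap M N (S : seq (M * N)) :
  partial_isometry S -> partial_isometry (map swap S).
Proof.
by move=> S_iso _ _ /mapP[p pS ->] /mapP[q qS ->] /=; rewrite S_iso.
Qed.

Lemma countable_enum (T : Type) (x0 : T) :
  countable [set: T] -> exists e : nat -> T, forall x, exists n, e n = x.
Proof.
move=> /countable_injP[f f_inj].
have /choice[e eP] n : exists x, (exists y, f y = n) -> f x = n.
  by have [[y yn]|nex] := pselect (exists y, f y = n); [exists y|exists x0].
by exists e => x; exists (f x); apply: f_inj; rewrite ?inE//; apply: eP; exists x.
Qed.

(** With enumerations [a] of [M] and [b] of [N], stage [n] of an increasing
    sequence of finite partial isometries puts [a n] into the domain and [b n]
    into the range; the union of the sequence is the graph of an isometry. *)
Lemma back_and_forth M N :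
  countable [set: M] -> extension_property M -> unit_rational_metric M ->
  countable [set: N] -> extension_property N -> unit_rational_metric N ->
  isometric M N.
Proof.
move=> cM extM ratM cN extN ratN.
(* The extension property over the empty set provides a point. *)
have [||x0 _] := extM [::]; [by []|by []|].
have [||y0 _] := extN [::]; [by []|by []|].
have [a aP] := countable_enum x0 cM; have [b bP] := countable_enum y0 cN.
have /choice[next nextP] (nS : nat * seq (M * N)) : exists S',
    partial_isometry nS.2 ->
    [/\ {subset nS.2 <= S'}, partial_isometry S',
      exists y, (a nS.1, y) \in S' & exists x, (x, b nS.1) \in S'].
  case: nS => n S /=.
  have [S_iso|] := pselect (partial_isometry S); last by exists [::].
  have [x xP] := partial_isometry_extend (b n) extM ratN S_iso.
  have [y] := partial_isometry_extend (a n) extN ratM (partial_isometry_swap xP).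
  move=> /partial_isometry_swap /=; rewrite -map_comp.
  rewrite (@eq_map _ _ (swap \o swap) id) ?map_id; last by case.
  exists [:: (a n, y), (x, b n) & S]; split=> //.
  - by move=> p pS; rewrite !inE pS !orbT.
  - by exists y; rewrite mem_head.
  - by exists x; rewrite !inE eqxx orbT.
pose S_ := fix S_ n := if n is m.+1 then next (m, S_ m) else [::].
have S_iso n : partial_isometry (S_ n).
  by elim: n => [|n /(nextP (n, _))[]].
have S_mono n m : (n <= m)%N -> {subset S_ n <= S_ m}.
  elim: m => [|m IH]; first by rewrite leqn0 => /eqP->.
  rewrite leq_eqVlt => /predU1P[->//|/IH nm p /nm].
  by have [+ _ _ _] := nextP (m, S_ m) (S_iso m); apply.
have S_dist n m p q : p \in S_ n -> q \in S_ m ->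
    mdist p.1 q.1 = mdist p.2 q.2.
  move=> pn qm; apply: (S_iso (maxn n m)).
  - exact: S_mono (leq_maxl _ _) _ pn.
  - exact: S_mono (leq_maxr _ _) _ qm.
have /choice[g gP] x : exists y n, (x, y) \in S_ n.
  have [n <-] := aP x.
  by have [_ _ [y yP] _] := nextP (n, S_ n) (S_iso n); exists y, n.+1.
exists g; apply: surjective_isometry => [x x'|y].
  have [n xn] := gP x; have [m xm] := gP x'.
  by rewrite -(S_dist _ _ _ _ xn xm).
have [n <-] := bP y.
have [_ _ _ [x xP]] := nextP (n, S_ n) (S_iso n).
exists x; apply: mdist_positivity; have [m xm] := gP x.
by rewrite -(S_dist m n.+1 _ _ xm xP) mdistxx.
Qed.

End back_and_forth.

(** * Removing balls *)

(** A point on the sphere of radius [r i] around [a i] is in none of the balls,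
    so prescribing one more distance, for a single [i], suffices to leave them
    all. *)
Lemma extension_property_remove_balls (R : realType) (U : metricType R)
    (I : Type) (r : I -> R) (a : I -> U) :
  extension_property U -> (forall i, unit_rational (r i)) ->
  (forall i j, i <> j -> r i + r j <= mdist (a i) (a j)) ->
  extension_property
    (set_type (~` \bigcup_(i : I) [set x : U | mdist (a i) x < r i])).
Proof.
move=> extU r_rat a_sep; set X := \bigcup_(i : I) _ => s s_kat s_rat.
pose s' := [seq (\val p.1, p.2) | p <- s].
have s'_kat : katetov s'.
  by move=> _ _ /mapP[p ps ->] /mapP[q qs ->]; exact: s_kat.
have s'_rat : {in s', forall p, unit_rational p.2}.
  by move=> _ /mapP[p ps ->]; exact: s_rat.
suff [z zX zE] : exists2 z, (~` X) z & {in s', forall p, mdist z p.1 = p.2}.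
  exists (SigSub (mem_set zX)) => p ps.
  by rewrite -[LHS]/(mdist z (\val p.1)) (zE (\val p.1, p.2))//; exact: map_f.
have [z zE] := extU _ s'_kat s'_rat.
have [[i _ /= zi]|zX] := pselect (X z); last by exists z.
have s'_far p : p \in s' -> r i <= mdist (a i) p.1.
  move=> /mapP[q qs ->] /=; rewrite leNgt; apply/negP => qi.
  by have /set_mem := valP q.1; apply; exists i.
have ri0 : 0 <= r i <= 1 by have [] := r_rat i.
(* The compatibility of the distance [r i] to [a i] with the other prescribed
   distances. Only the lower bound on [p.2 + mdist (a i) p.1] needs [p.1] to be
   outside of the ball; the others come from [mdist (a i) z < r i]. *)
have s'_near p : p \in s' -> p.2 - r i <= mdist (a i) p.1 <= p.2 + r i /\
                            r i - p.2 <= mdist (a i) p.1.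
  move=> ps; have := s'_far p ps; have := zE p ps.
  have := mdist_ge0 z p.1.
  have := metric_triangle z (a i) p.1; have := metric_triangle (a i) z p.1.
  by rewrite (metric_sym z (a i)); lra.
have [||w wE] := extU ((a i, r i) :: s').
- move=> p q; rewrite !inE => /predU1P[->|ps] /predU1P[->|qs] /=.
  + by rewrite mdistxx; lra.
  + by have := s'_near q qs; lra.
  + by rewrite metric_sym; have := s'_near p ps; lra.
  + exact: s'_kat.
- by move=> p; rewrite inE => /predU1P[->|/s'_rat//]; exact: r_rat.
have wi : mdist (a i) w = r i.
  by rewrite metric_sym (wE (a i, r i))// mem_head.
exists w => [[j _ /= wj]|p ps]; last by rewrite wE// inE ps orbT.
have [ij|ij] := pselect (i = j); first by move: wj; rewrite -ij wi ltxx.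
have := a_sep i j ij; have := metric_triangle (a i) w (a j).
by rewrite wi (metric_sym w); lra.
Qed.

Theorem theorem4p14 (R : realType) (U : metricType R)
    (hU : bounded_rational_urysohn U)
    (r : nat -> R) (hr : forall i, rational (r i) /\ 0 < r i <= 1)
    (a : nat -> U)
    (ha : forall i j, i <> j -> r i + r j <= mdist (a i) (a j)) :
  let X : set U := \bigcup_(i : nat) [set x : U | mdist (a i) x < r i] in
  isometric U (set_type (~` X)).
Proof.
move=> X.
have extU := urysohn_extension_property hU.
have ratU := urysohn_unit_rational hU.
have [cU _ _] := hU.
apply: back_and_forth => //.
- rewrite (eq_countable (card_setT _)).
  exact: sub_countable (subset_card_le (@subsetT _ _)) cU.
- apply: extension_property_remove_balls => // i.
  by have [ri_rat /andP[/ltW ri_ge0 ri_le1]] := hr i; split=> //; apply/andP.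
- by move=> x y; exact: ratU.
Qed.
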